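(* Let $a_i$, $i\in[n]$, form a minimal cover of $d$. Let $\Delta:=\sum_{i=1}^na_i-d$, $d_i:=d-\sum_{j\in[n]\setminus\{i\}}a_j=a_i-\Delta$, and $I^>:=\{i\in[n]\mid a_i>\Delta\}$; when $I^>\neq\emptyset$, let $i_0$ be any index in $I^>$ with $a_{i_0}=\min\{a_i\mid i\in I^>\}$. Let $\phi$ be the lifting function of the bilinear cover inequality $\sum_{i=1}^n\frac{\sqrt{a_i}}{\sqrt{a_i}-\sqrt{d_i}}(\sqrt{x_iy_i}-1)\ge-1$. Define $$\psi(\delta):=\begin{cases}l_+(\delta+\Delta)-1,&\delta\le-\Delta,\\ l_-\delta,&-\Delta\le\delta\le0,\\ l_+\delta,&0\le\delta,\end{cases}$$ where $l_-=\frac1\Delta$, and where $l_+=\frac{\sqrt{a_{i_0}}+\sqrt{d_{i_0}}}{\Delta\sqrt{d_{i_0}}}$ if $I^>\ne\emptyset$ and $l_+=\frac1\Delta$ otherwise. Then (i) $l_+\ge l_->0$; (ii) $\psi$ is subadditive over $\mathbb{R}$ (i.e., $\psi(\delta_1)+\psi(\delta_2)\ge\psi(\delta_1+\delta_2)$ for all $\delta_1,\delta_2\in\mathbb{R}$) with $\psi(0)=0$; and (iii) $\phi(\delta)\le\psi(\delta)$ for all $\delta\in\mathbb{R}$.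
   Context: $[n]=\{1,\dots,n\}$. Real numbers $a_1,\dots,a_n$ ($n\ge1$) form a minimal cover of $d\in\mathbb{R}$ if (i) $a_i>0$ for all $i\in[n]$ and $d>0$, (ii) $\sum_{i=1}^na_i>d$, and (iii) $\sum_{i\in K}a_i\le d$ for every $K\subsetneq[n]$. (Consequently $\Delta>0$, $a_i\ge\Delta$ and $d_i\ge0$.) The lifting function of the bilinear cover inequality is $$\phi(\delta)=\max\Big\{\sum_{i=1}^n\frac{\sqrt{a_i}}{\sqrt{a_i}-\sqrt{d_i}}\left(1-\sqrt{x_iy_i}\right)-1\ \Big|\ \sum_{i=1}^na_ix_iy_i\ge d-\delta,\ (x,y)\in[0,1]^{2n}\Big\},\qquad\delta\in\mathbb{R},$$ with $\phi(\delta)=-\infty$ if the problem is infeasible. *)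

(* Defs.v *)
(* MathComp world; the reals are an arbitrary [R : realType]. *)
From HB Require Import structures.
From mathcomp Require Import all_boot all_order all_algebra.
From mathcomp Require Import boolp classical_sets reals constructive_ereal ereal.

Set Implicit Arguments.
Unset Strict Implicit.
Unset Printing Implicit Defensive.

Import Order.TTheory GRing.Theory Num.Theory.

Local Open Scope ring_scope.

Definition minimal_cover (R : realType) (n : nat) (a : 'I_n -> R) (d : R) : Prop :=
  [/\ (forall i, 0 < a i) /\ 0 < d,
      d < \sum_(i < n) a i
    & forall K : {set 'I_n}, K \proper finset.setTfor 'I_n ->
        \sum_(i in K) a i <= d].

Definition excess (R : realType) (n : nat) (a : 'I_n -> R) (d : R) : R :=
  \sum_(i < n) a i - d.

Definition residual (R : realType) (n : nat) (a : 'I_n -> R) (d : R) (i : 'I_n) : R :=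
  d - \sum_(j < n | j != i) a j.

Definition Igt (R : realType) (n : nat) (a : 'I_n -> R) (d : R) : {set 'I_n} :=
  [set i | excess a d < a i]%SET.

Definition feasible (R : realType) (n : nat) (a : 'I_n -> R) (d delta : R)
    (x y : 'I_n -> R) : Prop :=
  (forall i, 0 <= x i <= 1 /\ 0 <= y i <= 1) /\
  d - delta <= \sum_(i < n) a i * x i * y i.

Definition objective (R : realType) (n : nat) (a : 'I_n -> R) (d : R)
    (x y : 'I_n -> R) : R :=
  \sum_(i < n)
    Num.sqrt (a i) / (Num.sqrt (a i) - Num.sqrt (residual a d i)) *
    (1 - Num.sqrt (x i * y i)) - 1.

(* The supremum is a maximum whenever the problem is feasible (a continuous
   function on a nonempty compact set), and is [-oo] when it is infeasible. *)
Definition phi (R : realType) (n : nat) (a : 'I_n -> R) (d delta : R) : \bar R :=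
  ereal_sup [set z : \bar R | exists x y : 'I_n -> R,
    feasible a d delta x y /\ z = (objective a d x y)%:E]%classic.

Definition lminus (R : realType) (n : nat) (a : 'I_n -> R) (d : R) : R :=
  1 / excess a d.

(* The value does not depend on [i0] when [Igt a d] is empty. *)
Definition lplus (R : realType) (n : nat) (a : 'I_n -> R) (d : R) (i0 : 'I_n) : R :=
  if Igt a d != finset.set0 then
    (Num.sqrt (a i0) + Num.sqrt (residual a d i0)) /
    (excess a d * Num.sqrt (residual a d i0))
  else 1 / excess a d.

(* The branches agree at the shared endpoints [- excess a d] and [0]. *)
Definition psi (R : realType) (n : nat) (a : 'I_n -> R) (d : R) (i0 : 'I_n)
    (delta : R) : R :=
  if delta <= - excess a d then lplus a d i0 * (delta + excess a d) - 1
  else if delta <= 0 then lminus a d * delta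
  else lplus a d i0 * delta.

(* Main.v *)
Require Import Defs.
From HB Require Import structures.
From mathcomp Require Import all_boot all_order all_algebra.
From mathcomp Require Import boolp classical_sets reals constructive_ereal ereal.
From mathcomp Require Import ring lra.

Set Implicit Arguments.
Unset Strict Implicit.
Unset Printing Implicit Defensive.

Import Order.TTheory GRing.Theory Num.Theory.

Local Open Scope ring_scope.

(** Write [D] for the excess and [m = lplus - lminus >= 0]. Then
    [psi delta = lminus * delta + m * kink D delta] with [kink D] a piecewise
    linear function that is constantly 0 on [- D <= delta <= 0] and of slope 1
    outside ([psi_kinkE]). So [psi] inherits subadditivity and monotonicity from
    [kink D], for which they are linear arithmetic.

    For the bound on [phi], put [s_i = sqrt (x_i y_i)] and
    [t_i = a_i (1 - s_i ^ 2)], the amount of the cover given up at index [i].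
    Feasibility says [\sum_i t_i <= D + delta], so it suffices to prove
    [objective + 1 <= g (\sum_i t_i)] where [g t = t / D + m * max (t - D) 0],
    that is [g t = 1 + psi (t - D)] for [t >= 0]. As [g] is convex with
    [g 0 = 0], it is superadditive on nonnegative reals
    ([sum_excess_part_le]), hence it suffices to bound each term of the
    objective by [g t_i] ([cover_term_le]). As a function of [t_i] that term
    is convex and agrees with [g] at [t_i = 0] and [t_i = D], so the bound for
    [0 <= t_i <= D] is a chord bound. If [a_i > D] the rest of the
    range, [D <= t_i <= a_i], is covered by a second chord bound. That chord has slope
    [(sqrt a_i + sqrt d_i) / (D sqrt d_i)], where [d_i = a_i - D]. This slope
    decreases in [a_i] ([chord_slope_anti]), so the smallest [a_i > D] gives
    the largest one, which is [lplus]. *)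

Section Kink.
Variable R : realType.
Implicit Types D t u : R.

Definition kink D t : R := Num.max t 0 + Num.min (t + D) 0.

Lemma kink_subadditive D t u : 0 <= D -> kink D (t + u) <= kink D t + kink D u.
Proof.
move=> D0; rewrite /kink.
by case: (leP t 0) => ?; case: (leP u 0) => ?; case: (leP (t + u) 0) => ?;
  case: (leP (t + D) 0) => ?; case: (leP (u + D) 0) => ?;
  case: (leP (t + u + D) 0) => ?; lra.
Qed.

Lemma kink_nondecreasing D : {homo kink D : t u / t <= u}.
Proof.
move=> t u tu; rewrite /kink.
by case: (leP t 0) => ?; case: (leP u 0) => ?;
  case: (leP (t + D) 0) => ?; case: (leP (u + D) 0) => ?; lra.
Qed.

(** Superadditivity is kept together with [0 <= \sum_i t i] because it fails
    for negative summands. *)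
Lemma sum_excess_part_le (I : Type) (r : seq I) D (t : I -> R) :
    0 <= D -> (forall i, 0 <= t i) ->
  0 <= \sum_(i <- r) t i /\
  \sum_(i <- r) Num.max (t i - D) 0 <= Num.max (\sum_(i <- r) t i - D) 0.
Proof.
move=> D0 t0.
apply: (big_ind2 (fun x y => 0 <= x /\ y <= Num.max (x - D) 0)).
- by rewrite lexx le_max lexx orbT.
- move=> x1 x2 y1 y2 [x10 lex1] [y10 ley1]; split; first exact: addr_ge0.
  move: lex1 ley1.
  by case: (leP (x1 - D) 0) => ?; case: (leP (y1 - D) 0) => ?;
    case: (leP (x1 + y1 - D) 0) => ?; lra.
- by [].
Qed.

End Kink.

Section Terms.
Variable R : realType.

(** Here [p], [q] are [sqrt a_i], [sqrt d_i]. If [q = 0] then the second chord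
    (from [D] to [a_i]) is a point; otherwise the hypothesis on [m] says that
    the slope of that chord is at most [1 / D + m], where
    [D = p ^ 2 - q ^ 2]. After multiplication by [D] the inequality reads
    [p (1 - s) (q - p s) <= D m max (q ^ 2 - p ^ 2 s ^ 2) 0]. *)
Lemma cover_term_le (p q s m : R) :
    0 <= q -> q < p -> 0 <= s <= 1 -> 0 <= m ->
    q = 0 \/ p <= (p ^+ 2 - q ^+ 2) * m * q ->
  p / (p - q) * (1 - s) <=
  p ^+ 2 * (1 - s ^+ 2) / (p ^+ 2 - q ^+ 2) +
  m * Num.max (p ^+ 2 * (1 - s ^+ 2) - (p ^+ 2 - q ^+ 2)) 0.
Proof.
move=> q0 qp /andP[s0 s1] m0 slope.
have pq : 0 < p - q by lra.
have pq' : 0 < p + q by lra.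
have ps0 : 0 <= p * s by apply: mulr_ge0 => //; lra.
have DE : p ^+ 2 - q ^+ 2 = (p - q) * (p + q) by ring.
have D0 : 0 < p ^+ 2 - q ^+ 2 by rewrite DE mulr_gt0.
set D := p ^+ 2 - q ^+ 2 in slope D0 DE *; set M := Num.max _ _.
rewrite -(ler_pM2l D0).
have -> : D * (p / (p - q) * (1 - s)) = p * (p + q) * (1 - s).
  by rewrite DE; field; lra.
rewrite [D * (_ + m * M)]mulrDr [D * (_ / D)]mulrC divfK ?gt_eqF // mulrA.
have diff : p * (p + q) * (1 - s) - p ^+ 2 * (1 - s ^+ 2) =
            p * (1 - s) * (q - p * s) by ring.
suff: p * (1 - s) * (q - p * s) <= D * m * M by lra.
have Dm0 : 0 <= D * m by rewrite mulr_ge0 // ltW.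
have [qps|psq] := leP q (p * s).
  apply: (@le_trans _ _ 0).
    by apply: mulr_ge0_le0; [apply: mulr_ge0; lra | lra].
  have M0 : 0 <= M by rewrite /M le_max lexx orbT.
  by rewrite mulr_ge0.
have q_gt0 : 0 < q by lra.
have {slope} slope : p <= D * m * q by case: slope => // q_eq0; lra.
have MB : (q - p * s) * (q + p * s) <= M.
  have -> : (q - p * s) * (q + p * s) = p ^+ 2 * (1 - s ^+ 2) - D.
    by rewrite /D; ring.
  by rewrite le_max lexx.
apply: le_trans (ler_wpM2l Dm0 MB).
rewrite [(q - _) * _]mulrC mulrA ler_wpM2r //; first by lra.
apply: (@le_trans _ _ (D * m * q * (1 - s))).
  by rewrite ler_wpM2r //; lra.
rewrite -mulrA ler_wpM2l //.
have : 0 <= q * s by rewrite mulr_ge0.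
lra.
Qed.

(** Both sides squared differ by [D (a - b)]. *)
Lemma chord_slope_anti (D a b : R) : 0 < D -> D <= b -> b <= a ->
  Num.sqrt a * Num.sqrt (b - D) <= Num.sqrt b * Num.sqrt (a - D).
Proof.
move=> D0 Db ba; rewrite -!sqrtrM; try lra.
rewrite ler_wsqrtr //.
have : 0 <= D * (a - b) by rewrite mulr_ge0 //; lra.
have -> : D * (a - b) = b * (a - D) - a * (b - D) by ring.
by rewrite subr_ge0.
Qed.

End Terms.

Section Cover.
Variables (R : realType) (n : nat) (a : 'I_n -> R) (d : R).

Lemma residualE i : residual a d i = a i - excess a d.
Proof. by rewrite /residual /excess [\sum_(j < n) a j](bigD1 i) //=; ring. Qed.

Lemma psi_kinkE i0 delta : 0 < excess a d ->
  psi a d i0 delta =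
  lminus a d * delta + (lplus a d i0 - lminus a d) * kink (excess a d) delta.
Proof.
move=> D0; rewrite /psi /kink; set D := excess a d; set L := lplus a d i0.
have lD : lminus a d * D = 1 by rewrite /lminus div1r mulVf ?gt_eqF.
set l := lminus a d in lD *.
have [h1|h1] := leP delta (- D).
  have [d0 dD0] : delta <= 0 /\ delta + D <= 0 by rewrite -/D in D0; lra.
  by rewrite (max_r d0) (min_l dD0) add0r -lD; ring.
rewrite (@min_r _ _ (delta + D)); last by lra.
by case: (leP delta 0) => ?; ring.
Qed.

Hypothesis hcover : minimal_cover a d.

Lemma excess_gt0 : 0 < excess a d.
Proof. by case: hcover => _ h _; rewrite /excess subr_gt0. Qed.

(** Minimality of the cover at the complement of [i]. *)
Lemma residual_ge0 i : 0 <= residual a d i.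
Proof.
case: hcover => _ _ /(_ [set j | j != i]%SET).
rewrite /residual subr_ge0 => H.
rewrite (eq_bigl (fun j => j \in [set j | j != i]%SET)); last first.
  by move=> j; rewrite inE.
apply: H; apply/properP; split; first exact/fintype.subsetP.
by exists i; rewrite !inE ?eqxx.
Qed.

Variable i0 : 'I_n.
Hypothesis hi0 : Igt a d != finset.set0 ->
  i0 \in Igt a d /\ (forall i, i \in Igt a d -> a i0 <= a i).

Lemma lplusB_lminus : Igt a d != finset.set0 ->
  excess a d * (lplus a d i0 - lminus a d) =
  Num.sqrt (a i0) / Num.sqrt (residual a d i0).
Proof.
move=> ne; have [+ _] := hi0 ne; rewrite inE => Da.
have D0 := excess_gt0.
have q0 : 0 < Num.sqrt (residual a d i0) by rewrite sqrtr_gt0 residualE; lra.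
by rewrite /lplus /lminus ne; field; rewrite !gt_eqF.
Qed.

Lemma lminus_le_lplus : lminus a d <= lplus a d i0.
Proof.
rewrite -subr_ge0 -(pmulr_rge0 _ excess_gt0).
have [e|ne] := eqVneq (Igt a d) finset.set0.
  by rewrite /lplus /lminus e eqxx subrr mulr0.
by rewrite lplusB_lminus // divr_ge0 ?sqrtr_ge0.
Qed.

(** The hypothesis on [m] in [cover_term_le], for [m = lplus - lminus]: it
    holds with equality at [i0], and [chord_slope_anti] transfers it to the
    other indices of [Igt a d]. *)
Lemma residual_slope i : Num.sqrt (residual a d i) = 0 \/
  Num.sqrt (a i) <=
  excess a d * (lplus a d i0 - lminus a d) * Num.sqrt (residual a d i).
Proof.
have D0 := excess_gt0.
have [ai|Da] := leP (a i) (excess a d).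
  by left; apply/eqP; rewrite sqrtr_eq0 residualE; lra.
have iI : i \in Igt a d by rewrite inE.
have ne : Igt a d != finset.set0 by apply/set0Pn; exists i.
have [+ /(_ i iI) le_i0i] := hi0 ne; rewrite inE => Da0; right.
rewrite lplusB_lminus // mulrAC ler_pdivlMr; last first.
  by rewrite sqrtr_gt0 residualE; lra.
by rewrite !residualE chord_slope_anti // ltW.
Qed.

Lemma objective_le_psi delta (x y : 'I_n -> R) :
  feasible a d delta x y -> objective a d x y <= psi a d i0 delta.
Proof.
move=> [xy01 cov]; have D0 := excess_gt0.
have lm := lminus_le_lplus.
rewrite psi_kinkE // /objective.
set D := excess a d in D0 *; set m := lplus a d i0 - lminus a d.
have m0 : 0 <= m by rewrite subr_ge0.
have z01 i : 0 <= x i * y i <= 1.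
  by have [/andP[? ?] /andP[? ?]] := xy01 i; rewrite mulr_ge0 // mulr_ile1.
have a0 i : 0 < a i by case: hcover => -[].
pose t i := a i * (1 - x i * y i).
have t0 i : 0 <= t i.
  have /andP[_ z1] := z01 i.
  by apply: mulr_ge0; [exact: ltW | rewrite subr_ge0].
have term_le i : Num.sqrt (a i) / (Num.sqrt (a i) - Num.sqrt (residual a d i)) *
    (1 - Num.sqrt (x i * y i)) <= lminus a d * t i + m * Num.max (t i - D) 0.
  have /andP[z0 z1] := z01 i.
  have DE : Num.sqrt (a i) ^+ 2 - Num.sqrt (residual a d i) ^+ 2 = D.
    by rewrite !sqr_sqrtr ?residual_ge0 ?ltW // residualE /D; ring.
  have := @cover_term_le R (Num.sqrt (a i)) (Num.sqrt (residual a d i))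
    (Num.sqrt (x i * y i)) m.
  rewrite DE (sqr_sqrtr z0) (sqr_sqrtr (ltW (a0 i))) -/(t i).
  rewrite [t i / D]mulrC -[D^-1]div1r -/(lminus a d); apply => //.
  - by rewrite ltr_sqrt // residualE gtrBl.
  - by rewrite sqrtr_ge0 -sqrtr1 ler_wsqrtr.
  - exact: residual_slope.
have [T0 sumM] := sum_excess_part_le (index_enum 'I_n) (ltW D0) t0.
set T := \sum_i t i in T0 sumM.
have TE : T = d + D - \sum_(i < n) a i * x i * y i.
  have -> : d + D = \sum_(i < n) a i by rewrite /D /excess; ring.
  rewrite -sumrB; apply: eq_bigr => i _.
  by rewrite /t; ring.
have TD : T - D <= delta by rewrite TE; lra.
have sum_le := ler_sum (index_enum 'I_n) (fun i (_ : true) => term_le i).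
rewrite big_split /= -!mulr_sumr -/T in sum_le.
(* The [min] part of [kink] vanishes at [T - D] because [0 <= T]. *)
have kT : kink D (T - D) = Num.max (T - D) 0.
  by rewrite /kink subrK (min_r T0) addr0.
have l0 : 0 <= lminus a d by rewrite divr_ge0 // ltW.
have mk : m * Num.max (T - D) 0 <= m * kink D delta.
  by rewrite -kT ler_wpM2l // kink_nondecreasing.
have lT : lminus a d * (T - D) <= lminus a d * delta by rewrite ler_wpM2l.
have lD : lminus a d * D = 1 by rewrite /lminus div1r mulVf ?gt_eqF.
have := ler_wpM2l m0 sumM.
by move: sum_le mk lT; rewrite mulrBr lD; lra.
Qed.

End Cover.

Theorem theorem5 (R : realType) (n : nat) (a : 'I_n -> R) (d : R) (i0 : 'I_n)
    (hn : (1 <= n)%N)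
    (hcover : minimal_cover a d)
    (hi0 : Igt a d != finset.set0 ->
       i0 \in Igt a d /\ (forall i, i \in Igt a d -> a i0 <= a i)) :
  [/\ lminus a d <= lplus a d i0 /\ 0 < lminus a d,
      (forall delta1 delta2 : R,
         psi a d i0 (delta1 + delta2) <= psi a d i0 delta1 + psi a d i0 delta2) /\
      psi a d i0 0 = 0
    & forall delta : R, (phi a d delta <= (psi a d i0 delta)%:E)%E].
Proof.
have D0 := excess_gt0 hcover.
have lm := lminus_le_lplus hcover hi0.
split.
- by split; rewrite // divr_gt0.
- split=> [t u|]; last first.
    by rewrite psi_kinkE // /kink add0r maxxx min_r ?(ltW D0) // addr0 !mulr0 addr0.
  rewrite !psi_kinkE // addrACA -!mulrDr lerD2l.
  by rewrite ler_wpM2l ?subr_ge0 // kink_subadditive // ltW.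
- move=> delta; apply: ge_ereal_sup => _ [x [y [feas ->]]].
  by rewrite lee_fin; exact: (objective_le_psi hcover hi0).
Qed.
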